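(* Let $G \subset \mathbb{C}^\times$ be a multiplicative subgroup, let $3 \leq k \leq N$ be integers, and let $A \in \mathbb{C}^{N \times N}$ be a non-zero Hermitian matrix that is $k$-PMP. Then the following hold. (1) Suppose $\{ I_1, \dots, I_m \}$ is a partition of $\{ 1, \dots, N \}$ satisfying the following conditions. (a) Each diagonal block $A_{I_j}$ of $A$ has rank at most one, and $A_{I_j} = \mathbf{u}_j \mathbf{u}_j^*$ for a unique vector $\mathbf{u}_j \in \mathbb{C}^{|I_j|}$ with first entry $\mathbf{u}_{j,1} \in [0, \infty)$. (b) The entries of each diagonal block $A_{I_j}$ lie in a single $G$-orbit. Then there exists a unique matrix $C = (c_{ij})_{i,j=1}^m$ such that $c_{ij} = 0$ unless $\mathbf{u}_i \neq 0$ and $\mathbf{u}_j \neq 0$, and $A$ is a block matrix with $$A_{I_i \times I_j} = c_{ij} \mathbf{u}_i \mathbf{u}_j^* \qquad (1 \leq i, j \leq m).$$ Moreover, the entries of each off-diagonal block of $A$ also lie in a single $G$-orbit. The matrix $C$ is Hermitian and $k$-PMP, with entries in the closed disc $\overline{D}(0,1)$, and the matrices $A$ and $C$ have equal rank. (2) Consider the condition (c). (c) The diagonal blocks of $A$ have maximal size, i.e., each diagonal block is not contained in a larger diagonal block that has rank one. There exists a partition $\{ I_1, \dots, I_m \}$ of $\{ 1, \dots, N \}$ such that (a), (b) and (c) hold, and such a partition is unique up to relabelling of the indices. (3) Suppose (a), (b) and (c) hold, and $G = \mathbb{C}^\times$. Then the off-diagonal entries of $C$ lie in the open disc $D(0,1)$.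 (4) If $G \subset S^1$, then diagonal blocks of $A$ in a single $G$-orbit (that is, whose entries all lie in a single $G$-orbit) have rank at most one.
   Context: A Hermitian matrix is called $k$-PMP (principal minor positive) if every principal $j \times j$ minor is non-negative for $j = 1, \dots, k$; for a Hermitian $m \times m$ matrix with $m < k$, this means that all principal minors are non-negative. For $I, J \subset \{1, \dots, N\}$, $A_{I \times J}$ denotes the submatrix of $A$ with rows indexed by $I$ and columns indexed by $J$, and $A_I := A_{I \times I}$. Given a partition $\{I_1, \dots, I_m\}$ of $\{1, \dots, N\}$, the diagonal blocks of $A$ are the $A_{I_j}$ and the off-diagonal blocks are the $A_{I_i \times I_j}$ with $i \neq j$; more generally, a diagonal block of $A$ is a principal submatrix $A_I$. The $G$-orbits are those of the action of $G$ on $\mathbb{C}$ by multiplication. Here $\mathbb{C}^\times = \mathbb{C} \setminus \{0\}$, $S^1 = \{ z \in \mathbb{C} : |z| = 1 \}$, $D(0,1) = \{ z \in \mathbb{C} : |z| < 1 \}$ and $\overline{D}(0,1) = \{ z \in \mathbb{C} : |z| \leq 1 \}$.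
   Formalization: In (c), the larger diagonal blocks excluded are those of rank at most one whose entries lie in a single G-orbit, not all those of rank one; read literally, (2) fails, e.g. for G = {1} and A = ww* with w = (1,2,3). *)

(* Defs.v *)
From mathcomp Require Import all_boot all_order all_algebra.
From mathcomp Require Import reals complex.

Set Implicit Arguments.
Unset Strict Implicit.
Unset Printing Implicit Defensive.

Import Order.TTheory GRing.Theory Num.Theory.
Local Open Scope ring_scope.
Local Open Scope sesquilinear_scope.

Section Definitions.
Variable R : realType.
Implicit Types (G : R[i] -> Prop) (k m n N : nat).

Definition mult_subgroup G : Prop :=
  [/\ ~ G 0, G 1, (forall x y, G x -> G y -> G (x * y))
    & (forall x, G x -> G x^-1)].

(* [enum_val] lists the elements of a set of ordinals in increasing order, so
   the rows and columns of the submatrix keep the order they have in [A]. *)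
Definition submx_of N (A : 'M[R[i]]_N) (I J : {set 'I_N}) :
    'M[R[i]]_(#|I|, #|J|) :=
  \matrix_(i, j) A (enum_val i) (enum_val j).

Definition diag_block N (A : 'M[R[i]]_N) (I : {set 'I_N}) : 'M[R[i]]_#|I| :=
  submx_of A I I.

(* In [R[i]], [0 <= z] means that [z] is real and non-negative. When [n < k]
   the condition ranges over all principal minors. *)
Definition kPMP k n (A : 'M[R[i]]_n) : Prop :=
  A \is hermsymmx /\
  forall J : {set 'I_n}, (0 < #|J| <= k)%N -> 0 <= \det (diag_block A J).

Definition orbit_of G (z w : R[i]) : Prop := exists2 g, G g & w = g * z.

Definition in_single_orbit G m n (M : 'M[R[i]]_(m, n)) : Prop :=
  exists z, forall i j, orbit_of G z (M i j).

(* Injectivity rules out repeated blocks, which the set of blocks forgets. *)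
Definition block_partition m N (I : 'I_m -> {set 'I_N}) : Prop :=
  injective I /\ partition [set I j | j in 'I_m] [set: 'I_N].

Definition block_vector N (A : 'M[R[i]]_N) (J : {set 'I_N})
    (v : 'cV[R[i]]_#|J|) : Prop :=
  diag_block A J = v *m v ^t* /\
  (forall i : 'I_#|J|, i = 0%N :> nat -> 0 <= v i 0).

Definition cond_a m N (A : 'M[R[i]]_N) (I : 'I_m -> {set 'I_N})
    (u : forall j, 'cV[R[i]]_#|I j|) : Prop :=
  forall j, (\rank (diag_block A (I j)) <= 1)%N /\
            unique (@block_vector N A (I j)) (u j).

Definition cond_b G m N (A : 'M[R[i]]_N) (I : 'I_m -> {set 'I_N}) : Prop :=
  forall j, in_single_orbit G (diag_block A (I j)).

(* The larger blocks to be excluded are those subject to the same constraints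
   as the blocks of the partition: rank at most one and entries in a single
   [G]-orbit. Excluding instead every larger block of rank exactly one would
   leave no admissible partition, e.g., for the identity subgroup and
   [A = w *m w ^t*] with [w] positive and non-constant; and allowing larger zero
   blocks would make the splitting of the zero rows of [A] arbitrary. *)
Definition cond_c G m N (A : 'M[R[i]]_N) (I : 'I_m -> {set 'I_N}) : Prop :=
  forall j (J : {set 'I_N}), I j \proper J ->
    ~ ((\rank (diag_block A J) <= 1)%N /\ in_single_orbit G (diag_block A J)).

Definition block_form m N (A : 'M[R[i]]_N) (I : 'I_m -> {set 'I_N})
    (u : forall j, 'cV[R[i]]_#|I j|) (C : 'M[R[i]]_m) : Prop :=
  (forall i j, ~ (u i != 0 /\ u j != 0) -> C i j = 0) /\
  (forall i j, submx_of A (I i) (I j) = C i j *: (u i *m (u j) ^t*)).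

End Definitions.

(* Main.v *)
Require Import Defs.
From mathcomp Require Import all_boot all_order all_algebra.
From mathcomp Require Import perm boolp reals complex ring.

Set Implicit Arguments.
Unset Strict Implicit.
Unset Printing Implicit Defensive.

Import Order.TTheory GRing.Theory Num.Theory.
Local Open Scope ring_scope.
Local Open Scope sesquilinear_scope.

(** Everything rests on one consequence of the non-negativity of the 3x3
    principal minors ([kPMP_rank1_pair]).  If the minor on [{p, q}] vanishes,
    then for every third index [r]
      [A q q * minor {p, q, r} = - |A p r * A q q - A p q * A q r| ^ 2],
    so the right-hand square must be zero: rows [p] and [q] of the whole of [A],
    and not only of the 2x2 block, are proportional.

    Call [p] and [q] linked when their rows are proportional by a factor [g]
    such that [g] and its conjugate lie in [G].  This is visibly an equivalence
    relation, and a diagonal block has rank at most one and entries in a single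
    [G]-orbit exactly when its indices are pairwise linked
    ([rank1_orbit_linked], [linked_rank1_orbit]).  Hence:

    - Part (2): a partition satisfies (a), (b) and (c) exactly when its blocks
      are the classes of this relation ([block_class]), which gives existence
      and uniqueness together.  On such a block the proportionality of the
      rows also produces the vector [u_j] ([block_vector_exists]).

    - Part (1): within a block all rows are proportional, and hence all columns
      too, so an off-diagonal block is determined by its entry at any chosen
      pair of representatives; it is a multiple of [u_i u_j^*], and a
      [G]-multiple of that entry throughout ([block_offdiag]).  The matrix [C]
      is obtained from [A] by keeping one index per block and rescaling by a
      diagonal congruence ([compression]); conversely [A] arises from [C] by
      repeating indices and rescaling.  Both passages have the form
      [congr_sub], which cannot increase the rank and, when no index is
      repeated, preserves the non-negativity of principal minors.  The bound
      on the entries of [C] then comes from its 2x2 minors, its diagonal being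
      made of zeros and ones.

    - Part (3): if [|C i j| = 1], then the representatives of the blocks [i] and
      [j] have a vanishing 2x2 minor and non-zero entries, so they are linked
      and the two blocks could be merged.

    - Part (4): if [G] consists of unimodular numbers, all the entries of a
      block in a single orbit have the same modulus, so its 2x2 minors vanish
      and its indices are pairwise linked. *)

(** * Determinants *)

Lemma det_mx22 (K : comPzRingType) (M : 'M[K]_2) :
  \det M = M 0 0 * M 1 1 - M 0 1 * M 1 0.
Proof.
rewrite (expand_det_row _ 0) !big_ord_recl big_ord0 /cofactor !det_mx11 /=.
rewrite !mxE /= (_ : lift 0 0 = 1 :> 'I_2); last exact/val_inj.
rewrite (_ : lift 1 0 = 0 :> 'I_2); last exact/val_inj.
by rewrite expr0 expr1 mul1r addr0 mulN1r mulrN.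
Qed.

Lemma det_mx33 (K : comPzRingType) (M : 'M[K]_3) :
  \det M = M 0 0 * (M 1 1 * M 2 2 - M 1 2 * M 2 1)
           - M 0 1 * (M 1 0 * M 2 2 - M 1 2 * M 2 0)
           + M 0 2 * (M 1 0 * M 2 1 - M 1 1 * M 2 0).
Proof.
rewrite (expand_det_row _ 0) !big_ord_recl big_ord0 /cofactor !det_mx22 /=.
rewrite !mxE /=.
have l0 : lift 0 0 = 1 :> 'I_3 by exact/val_inj.
have l1 : lift 0 1 = 2 :> 'I_3 by exact/val_inj.
have l2 : lift 1 0 = 0 :> 'I_3 by exact/val_inj.
have l3 : lift 1 1 = 2 :> 'I_3 by exact/val_inj.
have l4 : lift 2 0 = 0 :> 'I_3 by exact/val_inj.
have l5 : lift 2 1 = 1 :> 'I_3 by exact/val_inj.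
have l6 : lift 0 (lift ord0 ord0) = 2 :> 'I_3 by exact/val_inj.
rewrite !(l6, l0, l1, l2, l3, l4, l5).
rewrite expr0 mul1r expr1 /= /bump /= sqrrN expr1n mul1r mulN1r mulrN addr0.
by rewrite addrA.
Qed.

(** The index maps may have differently presented domains: the blocks of
    interest are indexed by an arbitrary list of distinct indices, those of the
    definition of principal minors by the increasing enumeration of a set. *)
Lemma det_mxsub_same_image (K : comPzRingType) n n' N (M : 'M[K]_N)
    (f : 'I_n -> 'I_N) (g : 'I_n' -> 'I_N) :
    injective f -> injective g -> n = n' ->
    (forall i, exists j, g j = f i) ->
  \det (mxsub f f M) = \det (mxsub g g M).
Proof.
move=> inj_f inj_g eq_n; case: n' / eq_n g inj_g => g inj_g.
move=> /fin_all_exists[s gsE].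
have inj_s : injective s by move=> i j /(congr1 g); rewrite !gsE => /inj_f.
have -> : mxsub f f M =
    row_perm (perm inj_s) (col_perm (perm inj_s) (mxsub g g M)).
  by apply/matrixP=> i j; rewrite !mxE !permE !gsE.
rewrite row_permE col_permE !det_mulmx !det_perm odd_permV.
by rewrite mulrCA -signr_addb addbb mulr1.
Qed.

(** * Matrices with non-negative small principal minors *)

Section PMP.
Variables (R : realType) (k N : nat) (A : 'M[R[i]]_N).
Hypothesis pmpA : kPMP k A.

Lemma kPMP_conj p q : A q p = (A p q)^*.
Proof.
case: pmpA => /is_hermitianmxP + _.
by rewrite expr0 scale1r => /matrixP/(_ q p); rewrite !mxE.
Qed.

(** Evaluating minors along an arbitrary injection avoids any reference to the
    order in which the indices of a set are listed. *)
Lemma kPMP_minor n (f : 'I_n -> 'I_N) :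
  injective f -> (0 < n <= k)%N -> 0 <= \det (mxsub f f A).
Proof.
move=> inj_f le_nk; case: pmpA => _ minorA.
have cardJ : #|[set f i | i : 'I_n]| = n by rewrite card_imset ?card_ord.
have /minorA : (0 < #|[set f i | i : 'I_n]| <= k)%N by rewrite cardJ.
suff -> : \det (mxsub f f A) = \det (diag_block A [set f i | i : 'I_n]) by [].
apply: det_mxsub_same_image => // [|i]; first exact: enum_val_inj.
have fiJ : f i \in [set f i | i : 'I_n] by apply: imset_f.
by exists (enum_rank_in fiJ (f i)); rewrite enum_rankK_in.
Qed.

Lemma kPMP_diag_ge0 p : (0 < k)%N -> 0 <= A p p.
Proof.
move=> lt0k; have := @kPMP_minor 1 (fun=> p); rewrite det_mx11 mxE; apply=> //.
by move=> i j _; rewrite !ord1.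
Qed.

Lemma kPMP_minor2 p q : (1 < k)%N -> A p q * A q p <= A p p * A q q.
Proof.
move=> lt1k; have [-> //|neq_pq] := eqVneq p q.
have := @kPMP_minor 2 (fun i => nth p [:: p; q] i); rewrite det_mx22 !mxE /=.
rewrite subr_ge0; apply=> // i j /eqP.
rewrite nth_uniq ?ltn_ord //; first by move/eqP/val_inj.
by rewrite /= inE neq_pq.
Qed.

Lemma kPMP_prop_rows p q p' q' g h :
    (forall r, A p r = g * A q r) -> (forall r, A p' r = h * A q' r) ->
  A p p' = g * A q q' * h^*.
Proof.
move=> pE p'E; rewrite pE (kPMP_conj p' q) p'E rmorphM /= -kPMP_conj.
by rewrite -mulrA (mulrC (A q q')).
Qed.

Lemma kPMP_zero_row p q : (1 < k)%N -> A p p = 0 -> A p q = 0.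
Proof.
move=> lt1k App0; have := kPMP_minor2 p q lt1k.
rewrite App0 mul0r (kPMP_conj p q) -normCK => le0.
have : `|A p q| ^+ 2 == 0 by rewrite eq_le le0 exprn_ge0.
by rewrite expf_eq0 /= normr_eq0 => /eqP.
Qed.

(** The heart of the argument: [A q q] times the 3x3 minor is minus the squared
    modulus of the difference of the two sides. *)
Lemma kPMP_rank1_pair p q r : (2 < k)%N ->
  A p p * A q q = A p q * A q p -> A p r * A q q = A p q * A q r.
Proof.
move=> lt2k pq1.
have [->|neq_pq] := eqVneq p q; first exact: mulrC.
have [->|neq_pr] := eqVneq r p; first by [].
have [-> //|neq_qr] := eqVneq r q.
have := @kPMP_minor 3 (fun i => nth p [:: p; q; r] i); rewrite det_mx33 !mxE /=.
set d := (X in 0 <= X) => /(_ _ lt2k) ge0d.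
have {}ge0d : 0 <= d.
  apply: ge0d => i j /eqP.
  rewrite nth_uniq ?ltn_ord //; first by move/eqP/val_inj.
  by rewrite /= !inE !negb_or neq_pq !(eq_sym _ r) neq_pr neq_qr.
set x := A p r * A q q - A p q * A q r.
have dE : A q q * d = - (x * x^*).
  rewrite /x rmorphB !rmorphM /= -!kPMP_conj.
  rewrite /d; ring: pq1.
have := mulr_ge0 (kPMP_diag_ge0 q (ltn_trans (isT : (0 < 2)%N) lt2k)) ge0d.
rewrite dE oppr_ge0 -normCK => le0.
have : `|x| ^+ 2 == 0 by rewrite eq_le le0 exprn_ge0.
by rewrite expf_eq0 /= normr_eq0 subr_eq0 => /eqP.
Qed.

Lemma kPMP_zero_col p q : (1 < k)%N -> A q q = 0 -> A p q = 0.
Proof.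
by move=> lt1k Aqq0; rewrite (kPMP_conj q) kPMP_zero_row ?rmorph0.
Qed.

End PMP.

(** * Diagonal congruences of generalized submatrices *)

(** The matrix [D *m B' *m D ^t*], where [D] is diagonal with entries [x] and
    [B'] is the submatrix of [B] along [f].  The map [f] need not be injective,
    so that both passing to a submatrix and repeating indices are covered. *)
Definition congr_sub (F : numClosedFieldType) m n (x : 'I_m -> F)
    (f : 'I_m -> 'I_n) (B : 'M[F]_n) : 'M[F]_m :=
  \matrix_(i, j) (x i * B (f i) (f j) * (x j)^*).

Lemma congr_subE (F : numClosedFieldType) m n (x : 'I_m -> F)
    (f : 'I_m -> 'I_n) (B : 'M[F]_n) :
  congr_sub x f B =
    diag_mx (\row_i x i) *m mxsub f f B *m diag_mx (\row_i (x i)^*).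
Proof.
by rewrite mul_diag_mx mul_mx_diag; apply/matrixP=> i j; rewrite !mxE.
Qed.

Lemma mxrank_congr_sub (F : numClosedFieldType) m n (x : 'I_m -> F)
    (f : 'I_m -> 'I_n) (B : 'M[F]_n) :
  (\rank (congr_sub x f B) <= \rank B)%N.
Proof.
rewrite congr_subE -[B in mxsub f f B]mul1mx -[B in mxsub f f (_ *m B)]mulmx1.
rewrite mxsub_mul -mulmx_colsub.
apply: leq_trans (mxrankM_maxl _ _) _; apply: leq_trans (mxrankM_maxr _ _) _.
by apply: leq_trans (mxrankM_maxr _ _) (mxrankM_maxl _ _).
Qed.

Lemma kPMP_congr_sub (R : realType) k m n (x : 'I_m -> R[i])
    (f : 'I_m -> 'I_n) (B : 'M[R[i]]_n) :
  injective f -> kPMP k B -> kPMP k (congr_sub x f B).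
Proof.
move=> inj_f pmpB; split.
  apply/is_hermitianmxP; rewrite expr0 scale1r; apply/matrixP=> i j.
  by rewrite !mxE !rmorphM /= conjCK -(kPMP_conj pmpB); ring.
move=> J leJk.
have -> : diag_block (congr_sub x f B) J =
    congr_sub (x \o enum_val) (f \o enum_val) B.
  by apply/matrixP=> i j; rewrite !mxE.
rewrite congr_subE !det_mulmx !det_diag mulrAC; apply: mulr_ge0.
  set y := \prod_i _; set z := \prod_i _.
  suff -> : z = y^* by rewrite mul_conjC_ge0.
  by rewrite /y /z rmorph_prod; apply: eq_bigr => i _; rewrite !mxE.
by apply: (kPMP_minor pmpB) => //; apply: inj_comp inj_f (@enum_val_inj _ _).
Qed.

(** * Linked indices *)

(** The conjugate of [g] is required to lie in [G] because, [A] being Hermitian,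
    it is the factor between the corresponding columns, and the entries of a
    non-zero block share an orbit only if both factors are in [G]. *)
Definition linked (R : realType) (G : R[i] -> Prop) N (A : 'M[R[i]]_N) p q :=
  exists g, [/\ G g, G g^* & forall r, A p r = g * A q r].

Definition rank1_orbit (R : realType) (G : R[i] -> Prop) N (A : 'M[R[i]]_N)
    (J : {set 'I_N}) :=
  (\rank (diag_block A J) <= 1)%N /\ in_single_orbit G (diag_block A J).

Lemma mxrank_le1_cross (F : fieldType) n (M : 'M[F]_n) i j :
  (\rank M <= 1)%N -> M i i * M j j = M i j * M j i.
Proof.
move: (\rank M) (col_base M) (row_base M) (mulmx_base M) => [|[|r]] U V <- // _.
  by rewrite !mxE !big_ord0 !mulr0.
by rewrite !mxE !big_ord1; ring.
Qed.

Section Linked.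
Variables (R : realType) (G : R[i] -> Prop) (k N : nat) (A : 'M[R[i]]_N).
Hypotheses (groupG : mult_subgroup G) (lt2k : (2 < k)%N) (pmpA : kPMP k A).

Let lt1k : (1 < k)%N. Proof. exact: ltn_trans lt2k. Qed.
Let lt0k : (0 < k)%N. Proof. exact: ltn_trans lt2k. Qed.

Lemma mult_subgroup_neq0 g : G g -> g != 0.
Proof. by case: groupG => nG0 _ _ _ Gg; apply/eqP => g0; rewrite g0 in Gg. Qed.

Lemma linked_refl p : linked G A p p.
Proof.
case: groupG => _ G1 _ _; exists 1; rewrite rmorph1.
by split=> // r; rewrite mul1r.
Qed.

Lemma linked_sym p q : linked G A p q -> linked G A q p.
Proof.
case: groupG => _ _ _ GV [g [Gg Ggc rowE]]; exists g^-1.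
rewrite fmorphV; split=> [||r]; [exact: GV | exact: GV |].
by rewrite rowE mulKf ?mult_subgroup_neq0.
Qed.

Lemma linked_trans q p r : linked G A p q -> linked G A q r -> linked G A p r.
Proof.
case: groupG => _ _ GM _ [g [Gg Ggc pE]] [h [Gh Ghc qE]]; exists (g * h).
rewrite rmorphM; split=> [||s]; [exact: GM | exact: GM |].
by rewrite pE qE mulrA.
Qed.

(** If [A q q] is non-zero, the factor between the rows is [A p q / A q q], and
    its conjugate is [A q p / A q q]; the orbit hypotheses say that both lie in
    [G].  If it is zero, then so is [A p p], both rows vanish, and the factor 1
    serves. *)
Lemma linked_of_cross p q : A p p * A q q = A p q * A q p ->
    orbit_of G (A q q) (A p p) -> orbit_of G (A q q) (A p q) ->
    orbit_of G (A q q) (A q p) ->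
  linked G A p q.
Proof.
move=> cross [g _ gE] [h Gh hE] [l Gl lE].
have [Aqq0|Aqq_neq0] := eqVneq (A q q) 0.
  case: groupG => _ G1 _ _; exists 1; rewrite rmorph1; split=> // r.
  rewrite (kPMP_zero_row pmpA r lt1k Aqq0) mulr0.
  by apply: (kPMP_zero_row pmpA) => //; rewrite gE Aqq0 mulr0.
exists h; split=> // [|r].
  rewrite (_ : h^* = l) //; apply: (mulIf Aqq_neq0).
  by rewrite -lE (kPMP_conj pmpA p q) hE rmorphM /= -(kPMP_conj pmpA).
apply: (mulIf Aqq_neq0).
by rewrite (kPMP_rank1_pair pmpA r lt2k cross) hE mulrAC.
Qed.

Lemma in_single_orbit_trans m n (M : 'M[R[i]]_(m, n)) i j i' j' :
  in_single_orbit G M -> orbit_of G (M i j) (M i' j').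
Proof.
case: groupG => _ _ GM GV [z Mz].
case: (Mz i j) (Mz i' j') => [g Gg ->] [h Gh ->].
exists (h * g^-1); first by apply: GM => //; apply: GV.
by rewrite mulrA divfK ?mult_subgroup_neq0.
Qed.

Lemma rank1_orbit_linked (J : {set 'I_N}) :
  rank1_orbit G A J -> {in J &, forall p q, linked G A p q}.
Proof.
move=> [rkJ orbJ] p q pJ qJ.
pose a := enum_rank_in pJ p; pose b := enum_rank_in pJ q.
have evE x y : diag_block A J x y = A (enum_val x) (enum_val y) by rewrite !mxE.
have [ea eb] : enum_val a = p /\ enum_val b = q by rewrite /a /b !enum_rankK_in.
apply: linked_of_cross.
- by have := mxrank_le1_cross a b rkJ; rewrite !evE ea eb.
- by have := in_single_orbit_trans b b a a orbJ; rewrite !evE ea eb.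
- by have := in_single_orbit_trans b b a b orbJ; rewrite !evE ea eb.
- by have := in_single_orbit_trans b b b a orbJ; rewrite !evE ea eb.
Qed.

Lemma linked_rank1_orbit (J : {set 'I_N}) :
  {in J &, forall p q, linked G A p q} -> rank1_orbit G A J.
Proof.
move=> linkJ; have [J0|[q qJ]] := set_0Vmem J.
  split; last first.
    exists 0 => a; suff : enum_val a \in set0 by rewrite inE.
    by rewrite -J0 enum_valP.
  by apply: leq_trans (rank_leq_row _) _; rewrite J0 cards0.
have /fin_all_exists[g gE] (a : 'I_#|J|) :
    exists g, [/\ G g, G g^* & forall r, A (enum_val a) r = g * A q r].
  exact: linkJ (enum_valP a) qJ.
have blockE a b : diag_block A J a b = g a * A q q * (g b)^*.
  case: (gE a) (gE b) => _ _ aE [_ _ bE].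
  by rewrite !mxE (kPMP_prop_rows pmpA aE bE).
split.
  have -> : diag_block A J = (\col_a (g a * A q q)) *m (\row_b (g b)^*).
    by apply/matrixP=> a b; rewrite blockE !mxE big_ord1 !mxE.
  by apply: leq_trans (mxrankM_maxl _ _) (rank_leq_col _).
exists (A q q) => a b; rewrite blockE; exists (g a * (g b)^*); last by ring.
by case: groupG (gE a) (gE b) => _ _ GM _ [Ga _ _] [_ Gb _]; apply: GM.
Qed.

Lemma unimodular_orbit_rank1 (J : {set 'I_N}) : (forall z, G z -> `|z| = 1) ->
  in_single_orbit G (diag_block A J) -> (\rank (diag_block A J) <= 1)%N.
Proof.
move=> G_unit orbJ; suff [] : rank1_orbit G A J by [].
apply: linked_rank1_orbit => p q pJ qJ.
have orb x y : x \in J -> y \in J -> orbit_of G (A q q) (A x y).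
  move=> xJ yJ.
  have := in_single_orbit_trans (enum_rank_in pJ q) (enum_rank_in pJ q)
    (enum_rank_in pJ x) (enum_rank_in pJ y) orbJ.
  by rewrite !mxE !enum_rankK_in.
have normA x y : x \in J -> y \in J -> `|A x y| = A q q.
  move=> xJ yJ; case: (orb x y xJ yJ) => g Gg ->.
  by rewrite normrM G_unit // mul1r ger0_norm // (kPMP_diag_ge0 pmpA).
apply: linked_of_cross; last 3 first.
1-3: exact: orb.
rewrite (kPMP_conj pmpA p q) -normCK normA // expr2.
by rewrite -[A p p]ger0_norm ?(kPMP_diag_ge0 pmpA) ?normA.
Qed.

End Linked.

(** * Indices and blocks of a partition *)

Section BlockPartition.
Variables (m N : nat) (I : 'I_m -> {set 'I_N}).
Hypothesis partI : block_partition I.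

Lemma block_card_gt0 j : (0 < #|I j|)%N.
Proof.
case: partI => _ /and3P[_ _ n0]; rewrite card_gt0.
by apply: contraNneq n0 => <-; apply: imset_f.
Qed.

Lemma block_of p : exists x : {j : 'I_m & 'I_#|I j|}, enum_val (tagged x) = p.
Proof.
case: partI => _ /and3P[/eqP coverI _ _].
have : p \in [set: 'I_N] by rewrite inE.
rewrite -coverI => /bigcupP[_ /imsetP[j _ ->] pI].
exists (Tagged (fun j => 'I_#|I j|) (enum_rank_in pI p)).
by rewrite /= enum_rankK_in.
Qed.

Lemma block_disjoint p i j : p \in I i -> p \in I j -> i = j.
Proof.
case: partI => injI /and3P[_ /trivIsetP trivI _] pi pj.
apply: injI; apply/eqP; apply/negPn/negP => neqI.
have IP l : I l \in [set I j | j in 'I_m] by apply: imset_f.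
have := trivI _ _ (IP i) (IP j) neqI.
by rewrite disjoint_subset => /subsetP/(_ p pi); rewrite inE pj.
Qed.

End BlockPartition.

(** * Block form of a matrix *)

Section Blocks.
Variables (R : realType) (G : R[i] -> Prop) (k N : nat) (A : 'M[R[i]]_N).
Hypotheses (groupG : mult_subgroup G) (lt2k : (2 < k)%N) (pmpA : kPMP k A).

Let lt1k : (1 < k)%N. Proof. exact: ltn_trans lt2k. Qed.
Let lt0k : (0 < k)%N. Proof. exact: ltn_trans lt2k. Qed.

Section BlockForm.
Variables (m : nat) (I : 'I_m -> {set 'I_N}) (u : forall j, 'cV[R[i]]_#|I j|).
Hypotheses (partI : block_partition I) (uA : cond_a A u) (orbI : cond_b G A I).

Lemma block_entry j a b :
  A (enum_val a) (enum_val b) = u j a 0 * (u j b 0)^*.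
Proof.
case: (uA j) => _ [[/matrixP/(_ a b) + _] _].
by rewrite !mxE big_ord1 !mxE.
Qed.

Lemma block_linked j (a b : 'I_#|I j|) :
  linked G A (enum_val a) (enum_val b).
Proof.
apply: (rank1_orbit_linked groupG lt2k pmpA (J := I j)) => //.
- by split; [case: (uA j) | apply: orbI].
- exact: enum_valP.
- exact: enum_valP.
Qed.

(** All the rows of a block are multiples of any one of them, so a zero entry
    of [u j] makes the whole diagonal of the block vanish. *)
Lemma block_vector_eq0 j a : u j a 0 = 0 -> u j = 0.
Proof.
move=> ua0; apply/matrixP=> b i; rewrite ord1 mxE; apply/eqP.
case: (block_linked b a) => g [_ _ /(_ (enum_val b))/eqP].
by rewrite !block_entry ua0 mul0r mulr0 mul_conjC_eq0.
Qed.

Lemma block_vector_linked j (a b : 'I_#|I j|) g :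
    (forall r, A (enum_val a) r = g * A (enum_val b) r) ->
  u j a 0 = g * u j b 0.
Proof.
move=> rowE; have [ub0|ub_neq0] := eqVneq (u j b 0) 0.
  by rewrite (block_vector_eq0 ub0) !mxE mulr0.
have := rowE (enum_val b); rewrite !block_entry mulrA => /mulIf; apply.
by rewrite conjC_eq0.
Qed.

Variable pt : forall j, 'I_#|I j|.

(** Moving from the representatives to other members of two blocks multiplies
    the entry of [A] by elements of [G], and these elements are the ratios of
    entries of [u i] and of the conjugate of [u j].  This gives both the
    rank-one form of the off-diagonal blocks and the statement on orbits. *)
Lemma block_offdiag i j (a : 'I_#|I i|) (b : 'I_#|I j|) : exists g h,
  [/\ G g, G h, u i a 0 = g * u i (pt i) 0, u j b 0 = h^* * u j (pt j) 0
    & A (enum_val a) (enum_val b) =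
      g * A (enum_val (pt i)) (enum_val (pt j)) * h].
Proof.
case: (block_linked a (pt i)) => g [Gg _ aE].
case: (block_linked b (pt j)) => h [Gh Ghc bE].
exists g, h^*; split=> //; rewrite ?conjCK; try exact: block_vector_linked.
exact: (kPMP_prop_rows pmpA).
Qed.

Lemma block_single_orbit i j : in_single_orbit G (submx_of A (I i) (I j)).
Proof.
exists (A (enum_val (pt i)) (enum_val (pt j))) => a b; rewrite mxE.
have [g [h [Gg Gh _ _ ->]]] := block_offdiag a b.
by exists (g * h); [case: groupG => _ _ GM _; apply: GM | ring].
Qed.

(** The only possible matrix [C]: its entry at [i, j] is read off at the
    representatives [pt i] and [pt j] of the two blocks.  Blocks with [u i = 0]
    need no separate treatment: since the inverse of 0 is 0, their rows and
    columns are zero. *)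
Definition compression : 'M[R[i]]_m :=
  congr_sub (fun i => (u i (pt i) 0)^-1) (fun i => enum_val (pt i)) A.

Lemma block_form_entry C i j a b : block_form A u C ->
  A (enum_val a) (enum_val b) = C i j * (u i a 0 * (u j b 0)^*).
Proof.
move=> [_ /(_ i j)/matrixP/(_ a b)].
by rewrite !mxE big_ord1 !mxE.
Qed.

Lemma block_form_compression : block_form A u compression.
Proof.
split=> i j.
  rewrite !mxE; have [-> _|ui0] := eqVneq (u i) 0.
    by rewrite mxE invr0 !mul0r.
  have [-> _|uj0 []//] := eqVneq (u j) 0.
  by rewrite mxE invr0 rmorph0 mulr0.
apply/matrixP=> a b; rewrite !mxE big_ord1 !mxE.
have [g [h [Gg Gh -> -> ->]]] := block_offdiag a b.
rewrite rmorphM fmorphV /= conjCK.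
have [ui0|ui_neq0] := eqVneq (u i (pt i) 0) 0.
  by rewrite (kPMP_zero_row pmpA) // ?block_entry ?ui0; ring.
have [uj0|uj_neq0] := eqVneq (u j (pt j) 0) 0.
  by rewrite (kPMP_zero_col pmpA) // ?block_entry ?uj0 ?rmorph0; ring.
have ujc_neq0 : (u j (pt j) 0)^* != 0 by rewrite conjC_eq0.
by field; apply/andP.
Qed.

Lemma block_form_eq C : block_form A u C -> C = compression.
Proof.
move=> formC; apply/matrixP=> i j; rewrite !mxE (block_form_entry _ _ formC).
have [ui0|ui_neq0] := eqVneq (u i (pt i) 0) 0.
  rewrite ui0 invr0 !mul0r; case: formC => -> // -[/eqP].
  by rewrite (block_vector_eq0 ui0).
have [uj0|uj_neq0] := eqVneq (u j (pt j) 0) 0.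
  rewrite uj0 invr0 rmorph0 !mulr0; case: formC => -> // -[_ /eqP].
  by rewrite (block_vector_eq0 uj0).
have ujc_neq0 : (u j (pt j) 0)^* != 0 by rewrite conjC_eq0.
by rewrite fmorphV /=; field; apply/andP.
Qed.

Lemma kPMP_compression : kPMP k compression.
Proof.
apply: kPMP_congr_sub => // i j eq_pt.
apply: (block_disjoint partI (p := enum_val (pt i))); last rewrite eq_pt.
  exact: enum_valP.
exact: enum_valP.
Qed.

Lemma compression_diag_le1 i : 0 <= compression i i <= 1.
Proof.
rewrite (kPMP_diag_ge0 kPMP_compression) //= mxE block_entry.
have [->|ui_neq0] := eqVneq (u i (pt i) 0) 0.
  by rewrite invr0 !mul0r ler01.
by rewrite fmorphV /= mulKf // mulfV // conjC_eq0.
Qed.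

Lemma compression_norm_le1 i j : `|compression i j| <= 1.
Proof.
rewrite -(@expr_le1 _ 2) // normCK -(kPMP_conj kPMP_compression).
apply: le_trans (kPMP_minor2 kPMP_compression i j lt1k) _.
case/andP: (compression_diag_le1 i) => ge0i le1i.
by case/andP: (compression_diag_le1 j) => ge0j le1j; apply: mulr_ile1.
Qed.

(** [C] is a rescaled submatrix of [A], and [A] is recovered from [C] by
    repeating the index of each block and rescaling with the entries of [u]. *)
Lemma mxrank_compression : \rank A = \rank compression.
Proof.
apply/eqP; rewrite eqn_leq mxrank_congr_sub andbT.
have /fin_all_exists[x xE] := block_of partI.
suff {1}-> : A = congr_sub (fun p => u (tag (x p)) (tagged (x p)) 0)
    (fun p => tag (x p)) compression by apply: mxrank_congr_sub.
apply/matrixP=> p q; rewrite [RHS]mxE -{1}(xE p) -{1}(xE q).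
by rewrite (block_form_entry _ _ block_form_compression) mulrCA mulrA.
Qed.

(** An entry of modulus one makes the 2x2 minor of the two representatives
    vanish.  As [G] contains every non-zero number, they are then linked, and
    so are all members of the two blocks, against maximality. *)
Lemma compression_norm_lt1 i j :
    cond_c G A I -> (forall z, G z <-> z != 0) -> i != j ->
  `|compression i j| < 1.
Proof.
move=> maxI Gnz neq_ij; rewrite lt_neqAle compression_norm_le1 andbT.
apply/negP => /eqP norm1.
pose p := enum_val (pt i); pose q := enum_val (pt j).
have C_neq0 : compression i j != 0 by rewrite -normr_eq0 norm1 oner_neq0.
have ui_neq0 : u i (pt i) 0 != 0.
  by apply: contraNneq C_neq0 => ui0; rewrite mxE ui0 invr0 !mul0r.
have uj_neq0 : u j (pt j) 0 != 0.
  by apply: contraNneq C_neq0 => uj0; rewrite mxE uj0 invr0 rmorph0 mulr0.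
have ApqE : A p q = compression i j * (u i (pt i) 0 * (u j (pt j) 0)^*).
  exact: block_form_entry block_form_compression.
have Aqp_neq0 : A p q != 0 by rewrite ApqE !mulf_neq0 ?conjC_eq0.
have link_pq : linked G A p q.
  have Aqq_neq0 : A q q != 0 by rewrite block_entry mulf_neq0 ?conjC_eq0.
  have orb z : z != 0 -> orbit_of G (A q q) z.
    move=> z_neq0; exists (z / A q q); last by rewrite divfK.
    by apply/Gnz; rewrite mulf_neq0 ?invr_eq0.
  apply: (linked_of_cross groupG lt2k pmpA) => //; last 3 first.
  - by apply: orb; rewrite block_entry mulf_neq0 ?conjC_eq0.
  - exact: orb.
  - by apply: orb; rewrite (kPMP_conj pmpA p q) conjC_eq0.
  rewrite (kPMP_conj pmpA p q) -normCK ApqE !normrM norm1 norm_conjC mul1r.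
  by rewrite exprMn !normCK !block_entry.
apply: (maxI i (I i :|: I j)).
  rewrite properEneq subsetUl andbT; apply/eqP=> eqU.
  case/eqP: neq_ij; apply: (block_disjoint partI (p := q)).
    by rewrite eqU inE enum_valP orbT.
  exact: enum_valP.
have link_p r : r \in I i :|: I j -> linked G A r p.
  rewrite inE => /orP[rI|rJ].
    by rewrite -(enum_rankK_in rI rI); apply: block_linked.
  apply: (linked_trans groupG) (linked_sym groupG link_pq).
  by rewrite -(enum_rankK_in rJ rJ); apply: block_linked.
apply: (linked_rank1_orbit groupG pmpA) => r s /link_p rp /link_p sp.
exact: (linked_trans groupG) rp (linked_sym groupG sp).
Qed.

End BlockForm.

(** With [q] the first index of [J] and [g a] the factor from row [q] to row
    [a], the vector has entries [g a * sqrt (A q q)].  It is the only one: the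
    condition on the first entry forces the value [sqrt (A q q)] there, and the
    column of [q] in the block forces the others. *)
Lemma block_vector_exists (J : {set 'I_N}) (a0 : 'I_#|J|) : a0 = 0%N :> nat ->
    rank1_orbit G A J ->
  exists v, unique (@block_vector R N A J) v.
Proof.
move=> a00 oneJ; pose q := enum_val a0.
have /fin_all_exists[g gE] (a : 'I_#|J|) :
    exists g, forall r, A (enum_val a) r = g * A q r.
  have linkJ := rank1_orbit_linked groupG lt2k pmpA oneJ.
  have [g [_ _ gE]] := linkJ (enum_val a) q (enum_valP a) (enum_valP a0).
  by exists g.
have blockE a b : diag_block A J a b = g a * A q q * (g b)^*.
  by rewrite !mxE (kPMP_prop_rows pmpA (gE a) (gE b)).
have Aqq_ge0 : 0 <= A q q by apply: (kPMP_diag_ge0 pmpA).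
have first_a0 (i : 'I_#|J|) : i = 0%N :> nat -> i = a0.
  by move=> i0; apply/val_inj; rewrite /= i0 a00.
exists (\col_a (g a * sqrtC (A q q))); split.
  split.
    apply/matrixP=> a b; rewrite blockE !mxE big_ord1 !mxE rmorphM /=.
    rewrite (conj_Creal (x := sqrtC _)) ?ger0_real ?sqrtC_ge0 //.
    by rewrite -{1}[A q q]sqrtCK; ring.
  move=> i /first_a0->; rewrite mxE.
  have [Aqq0|Aqq_neq0] := eqVneq (A q q) 0; first by rewrite Aqq0 sqrtC0 mulr0.
  have /(mulIf Aqq_neq0) <- : 1 * A q q = g a0 * A q q by rewrite -gE mul1r.
  by rewrite mul1r sqrtC_ge0.
move=> v [blockv v_ge0].
have {}blockv a b : g a * A q q * (g b)^* = v a 0 * (v b 0)^*.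
  by rewrite -blockE blockv !mxE big_ord1 !mxE.
apply/matrixP=> a i; rewrite (ord1 i) mxE {i}.
have [Aqq0|Aqq_neq0] := eqVneq (A q q) 0.
  rewrite Aqq0 sqrtC0 mulr0; apply/esym/eqP.
  by rewrite -mul_conjC_eq0 -blockv Aqq0 mulr0 mul0r.
have g1 : g a0 = 1 by apply: (mulIf Aqq_neq0); rewrite -gE mul1r.
have va0 : v a0 0 = sqrtC (A q q).
  have := blockv a0 a0; rewrite g1 rmorph1 mul1r mulr1 => ->.
  by rewrite -normCK sqrCK // ger0_norm // v_ge0.
have := blockv a a0; rewrite va0 g1 rmorph1 mulr1.
rewrite (conj_Creal (x := sqrtC _)) ?ger0_real ?sqrtC_ge0 //.
rewrite -{1}[A q q]sqrtCK expr2 mulrA => /mulIf; apply.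
by rewrite sqrtC_eq0.
Qed.

(** A linked class is itself an admissible block, so by maximality a block
    cannot be strictly contained in the class of one of its indices. *)
Lemma block_class m (I : 'I_m -> {set 'I_N})
    (u : forall j, 'cV[R[i]]_#|I j|) j p q :
    cond_a A u -> cond_b G A I -> cond_c G A I -> p \in I j ->
  q \in I j <-> linked G A p q.
Proof.
move=> uA orbI maxI pI.
have link : {in I j &, forall p q, linked G A p q}.
  apply: (rank1_orbit_linked groupG lt2k pmpA).
  by split; [case: (uA j) | apply: orbI].
split=> [qI|pq]; first exact: link.
pose J := [set r | `[< linked G A p r >]].
have subJ : I j \subset J.
  by apply/subsetP=> r rI; rewrite inE; apply/asboolP; apply: link.
apply/negPn/negP => qI; apply: (maxI j J).
  by apply/properP; split=> //; exists q => //; rewrite inE; apply/asboolP.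
apply: (linked_rank1_orbit groupG pmpA) => r s.
rewrite !inE => /asboolP pr /asboolP ps.
exact: (linked_trans groupG (linked_sym groupG pr) ps).
Qed.

Lemma max_partition_exists :
  exists (m : nat) (I : 'I_m -> {set 'I_N}) (u : forall j, 'cV[R[i]]_#|I j|),
    [/\ block_partition I, cond_a A u, cond_b G A I & cond_c G A I].
Proof.
pose rl p q := `[< linked G A p q >].
have rl_equiv : {in [set: 'I_N] & &, equivalence_rel rl}.
  move=> p q r _ _ _; split; first exact/asboolP/linked_refl.
  move=> /asboolP pq; apply/asboolP/asboolP => [pr|qr].
    exact: (linked_trans groupG (linked_sym groupG pq) pr).
  exact: (linked_trans groupG pq qr).
pose P := equivalence_partition rl [set: 'I_N].
have partP : partition P [set: 'I_N] := equivalence_partitionP rl_equiv.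
have classP (X : {set 'I_N}) p q :
    X \in P -> p \in X -> (q \in X) <-> linked G A p q.
  case/and3P: partP => _ trivP _ XP pX.
  rewrite -(def_pblock trivP XP pX) pblock_equivalence_partition ?inE //.
  by split=> /asboolP.
pose I (j : 'I_#|P|) := enum_val j.
have IP j : I j \in P by apply: enum_valP.
have IE : [set I j | j in 'I_#|P|] = P.
  apply/setP=> X; apply/imsetP/idP => [[j _ ->]|XP]; first exact: IP.
  by exists (enum_rank_in XP X); rewrite /I ?enum_rankK_in.
have oneI j : rank1_orbit G A (I j).
  apply: (linked_rank1_orbit groupG pmpA) => p q pI qI.
  by apply/(classP (I j)).
have partI : block_partition I by split; [exact: enum_val_inj | rewrite IE].
have /fin_all_exists[u uE] j : exists v, unique (@block_vector R N A (I j)) v.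
  exact: (block_vector_exists (a0 := Ordinal (block_card_gt0 partI j))).
exists #|P|, I, u; split=> //.
- by move=> j; split; [case: (oneI j) | apply: uE].
- by move=> j; case: (oneI j).
move=> j J ltJ oneJ; case/properP: ltJ => /subsetP subJ [q qJ /negP[]].
pose a := Ordinal (block_card_gt0 partI j); have aI := enum_valP a.
apply/(classP (I j) (enum_val a)) => //.
by apply: (rank1_orbit_linked groupG lt2k pmpA oneJ) => //; apply: subJ.
Qed.

Lemma max_partition_unique m m' (I : 'I_m -> {set 'I_N})
    (I' : 'I_m' -> {set 'I_N})
    (u : forall j, 'cV[R[i]]_#|I j|) (u' : forall j, 'cV[R[i]]_#|I' j|) :
    [/\ block_partition I, cond_a A u, cond_b G A I & cond_c G A I] ->
    [/\ block_partition I', cond_a A u', cond_b G A I' & cond_c G A I'] ->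
  exists s : 'I_m -> 'I_m', bijective s /\ forall j, I' (s j) = I j.
Proof.
have same n n' (K : 'I_n -> {set 'I_N}) (K' : 'I_n' -> {set 'I_N})
    (v : forall j, 'cV[R[i]]_#|K j|) (v' : forall j, 'cV[R[i]]_#|K' j|) :
    [/\ block_partition K, cond_a A v, cond_b G A K & cond_c G A K] ->
    [/\ block_partition K', cond_a A v', cond_b G A K' & cond_c G A K'] ->
    exists s : 'I_n -> 'I_n', forall j, K' (s j) = K j.
  move=> [pK aK bK cK] [pK' aK' bK' cK'].
  apply: (@fin_all_exists _ _ (fun j j' => K' j' = K j)) => j.
  pose a := Ordinal (block_card_gt0 pK j); have aK0 := enum_valP a.
  have [[j' a'] /= a'E] := block_of pK' (enum_val a).
  have aK0' : enum_val a \in K' j' by rewrite -a'E enum_valP.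
  exists j'; apply/setP=> q; apply/idP/idP.
    by move/(block_class q aK' bK' cK' aK0')/(block_class q aK bK cK aK0).
  by move/(block_class q aK bK cK aK0)/(block_class q aK' bK' cK' aK0').
move=> hI hI'; have [s sE] := same _ _ _ _ _ _ hI hI'.
have [t tE] := same _ _ _ _ _ _ hI' hI.
have [[injI _] _ _ _] := hI; have [[injI' _] _ _ _] := hI'.
exists s; split=> //; exists t => j; first by apply: injI; rewrite tE sE.
by apply: injI'; rewrite sE tE.
Qed.

End Blocks.

(** * The theorem *)

Theorem theorem4p4 (R : realType) (G : R[i] -> Prop) (k N : nat)
    (A : 'M[R[i]]_N) (hG : mult_subgroup G) (hk : (3 <= k <= N)%N)
    (hA0 : A != 0) (hA : kPMP k A) :
  [/\ (* (1) *)
      forall (m : nat) (I : 'I_m -> {set 'I_N})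
             (u : forall j, 'cV[R[i]]_#|I j|),
        block_partition I -> cond_a A u -> cond_b G A I ->
        [/\ exists! C : 'M[R[i]]_m, block_form A u C,
            forall i j, i != j -> in_single_orbit G (submx_of A (I i) (I j))
          & forall C : 'M[R[i]]_m, block_form A u C ->
              [/\ C \is hermsymmx, kPMP k C, forall i j, `|C i j| <= 1
                & \rank A = \rank C]],
      (* (2) *)
      (exists (m : nat) (I : 'I_m -> {set 'I_N})
              (u : forall j, 'cV[R[i]]_#|I j|),
         [/\ block_partition I, cond_a A u, cond_b G A I & cond_c G A I]) /\
      (forall (m m' : nat) (I : 'I_m -> {set 'I_N}) (I' : 'I_m' -> {set 'I_N})
              (u : forall j, 'cV[R[i]]_#|I j|)
              (u' : forall j, 'cV[R[i]]_#|I' j|),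
         [/\ block_partition I, cond_a A u, cond_b G A I & cond_c G A I] ->
         [/\ block_partition I', cond_a A u', cond_b G A I' & cond_c G A I'] ->
         exists s : 'I_m -> 'I_m', bijective s /\ forall j, I' (s j) = I j),
      (* (3) *)
      forall (m : nat) (I : 'I_m -> {set 'I_N})
             (u : forall j, 'cV[R[i]]_#|I j|) (C : 'M[R[i]]_m),
        block_partition I -> cond_a A u -> cond_b G A I -> cond_c G A I ->
        (forall z, G z <-> z != 0) ->
        block_form A u C ->
        forall i j, i != j -> `|C i j| < 1
    & (* (4) *)
      (forall z, G z -> `|z| = 1) ->
      forall J : {set 'I_N}, in_single_orbit G (diag_block A J) ->
        (\rank (diag_block A J) <= 1)%N].
Proof.
have lt2k : (2 < k)%N by case/andP: hk.
split.
- move=> m I u partI uA orbI.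
  pose pt j := Ordinal (block_card_gt0 partI j).
  have eqC := block_form_eq hG lt2k hA uA orbI pt.
  split.
  + exists (compression A u pt); split; last by move=> C /eqC.
    exact: (block_form_compression hG lt2k hA uA orbI pt).
  + by move=> i j _; apply: (block_single_orbit hG lt2k hA uA orbI pt).
  + move=> C /eqC ->; have pmpC := kPMP_compression hA u partI pt.
    split=> //; first by case: pmpC.
      exact: (compression_norm_le1 lt2k hA partI uA).
    exact: (mxrank_compression hG lt2k hA partI uA orbI).
- split; first exact: (max_partition_exists hG lt2k hA).
  move=> m m' I I' u u'; exact: (max_partition_unique hG lt2k hA).
- move=> m I u C partI uA orbI maxI Gnz.
  pose pt j := Ordinal (block_card_gt0 partI j).
  move=> /(block_form_eq hG lt2k hA uA orbI pt) -> i j.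
  exact: (compression_norm_lt1 hG lt2k hA partI uA orbI).
- move=> G_unit J; exact: (unimodular_orbit_rank1 hG lt2k hA).
Qed.
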